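(* Let $k$ be a field, let $Q=(Q_0,Q_1)$ be the Hopf quiver determined by a group $G$ and ramification data $r$ for $G$, let $\mathcal{C}_Q$ be the category of paths in $Q$, and let $\cdot:kQ\times kQ\to kQ$ be the multiplication of the associated (canonical) Cibils–Rosso Hopf algebra structure on the path coalgebra $kQ$. Then $\cdot$ is the $k$-bilinear extension of a (strict) monoidal product on the category $\mathcal{C}_Q$ if and only if $Q_1=\emptyset$.
   Context: Ramification data for a group $G$ is a formal sum $r=\sum_{C\in\mathfrak{C}}r_C C$, where $\mathfrak{C}$ is the set of conjugacy classes of $G$ and all $r_C\in\mathbb{N}$ (zero allowed). The Hopf quiver determined by $(G,r)$ is the quiver with vertex set $Q_0=G$ and, for all $g,c\in G$, exactly $r_C$ arrows from $g$ to $cg$, where $C$ is the conjugacy class of $c$. For a quiver $Q$, $\mathcal{C}_Q$ is its path category (objects: vertices; morphisms: paths, including the trivial paths $i_a$ as identities; composition: concatenation, $a\circ b$ meaning first $b$ then $a$). The path coalgebra $kQ=k\mathcal{C}_Q$ is the free $k$-module on the set of all paths with $\Delta(f)=\sum_{a\circ b=f}a\otimes b$, and $\varepsilon(f)=1$ if $f$ is a trivial path and $0$ otherwise. It is graded by path length; $kQ_0$ and $kQ_1$ denote the components of degree 0 and 1, and $\pi_0,\pi_1$ the projections onto them. Canonical Hopf algebra structure: for a Hopf quiver, $kQ_0=kG$ carries the group algebra multiplication. For each conjugacy class $C$ and each $c\in C$, $g\in G$, denote by $(c\otimes g)_j$, $j=1,\dots,r_C$, the arrows from $g$ to $cg$,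 so that $kQ_1\cong\bigoplus_{C}r_C\,kC\otimes kQ_0$ as a vector space. The $kQ_0$-bimodule structure on $kQ_1$ is $$x\,(c\otimes g)_j\,y=(xcx^{-1}\otimes xgy)_j\qquad(x,y\in G),$$ and the $kQ_0$-bicomodule structure is $(c\otimes g)_j\mapsto cg\otimes(c\otimes g)_j\otimes g$. The multiplication $\mu$ on $kQ$ is the unique coalgebra map $\mu:kQ\otimes kQ\to kQ$ such that $\pi_0\mu=m\circ(\pi_0\otimes\pi_0)$, where $m$ is the multiplication of $kG$, and $\pi_1\mu=\alpha_L\circ(\pi_0\otimes\pi_1)+\alpha_R\circ(\pi_1\otimes\pi_0)$, where $\alpha_L:kQ_0\otimes kQ_1\to kQ_1$ and $\alpha_R:kQ_1\otimes kQ_0\to kQ_1$ are the left and right actions above. It makes $kQ$ into a graded Hopf algebra. A monoidal product on $\mathcal{C}_Q$ is the product functor $\mathcal{C}_Q\times\mathcal{C}_Q\to\mathcal{C}_Q$ of a strict monoidal category structure on $\mathcal{C}_Q$; being its bilinear extension means that the product of two paths in $kQ$ is the path given by their monoidal product. *)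

(* Defs.v *)
From HB Require Import structures.
From mathcomp Require Import all_boot all_order all_algebra.
From mathcomp Require Import boolp classical_sets.
From mathcomp Require Import finmap monalg.

Set Implicit Arguments.
Unset Strict Implicit.
Unset Printing Implicit Defensive.

Import GRing.Theory.
Local Open Scope ring_scope.

Obligation Tactic := idtac.

(** * Small categories, functors, strict monoidal structures *)

(* Categories are presented with a single type of morphisms; [comp g f] is
   "first f, then g" and exists only for composable morphisms. *)
Record category := Category {
  Ob : Type;
  Mor : Type;
  dom : Mor -> Ob;
  cod : Mor -> Ob;
  idm : Ob -> Mor;
  comp : forall g f : Mor, dom g = cod f -> Mor;
  dom_idm : forall a, dom (idm a) = a;
  cod_idm : forall a, cod (idm a) = a;
  dom_comp : forall g f (e : dom g = cod f), dom (comp e) = dom f;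
  cod_comp : forall g f (e : dom g = cod f), cod (comp e) = cod g;
  comp_idl : forall f (e : dom (idm (cod f)) = cod f), comp e = f;
  comp_idr : forall f (e : dom f = cod (idm (dom f))), comp e = f;
  compA : forall h g f (e : dom h = cod g) (e' : dom g = cod f)
    (e1 : dom (comp e) = cod f) (e2 : dom h = cod (comp e')),
    comp e1 = comp e2
}.

Record functor (C D : category) := Functor {
  fob : Ob C -> Ob D;
  fmor : Mor C -> Mor D;
  dom_fmor : forall f, dom (fmor f) = fob (dom f);
  cod_fmor : forall f, cod (fmor f) = fob (cod f);
  fmor_idm : forall a, fmor (idm a) = idm (fob a);
  fmor_comp : forall g f (e : dom g = cod f)
    (e' : dom (fmor g) = cod (fmor f)), fmor (comp e) = comp e'
}.

Program Definition prod_cat (C D : category) : category := {|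
  Ob := Ob C * Ob D;
  Mor := Mor C * Mor D;
  dom := fun f => (dom f.1, dom f.2);
  cod := fun f => (cod f.1, cod f.2);
  idm := fun a => (idm a.1, idm a.2);
  comp := fun g f e => (comp (congr1 fst e), comp (congr1 snd e))
|}.
Next Obligation. by move=> C D [a b]; rewrite /= !dom_idm. Qed.
Next Obligation. by move=> C D [a b]; rewrite /= !cod_idm. Qed.
Next Obligation. by move=> C D g f e; rewrite /= !dom_comp. Qed.
Next Obligation. by move=> C D g f e; rewrite /= !cod_comp. Qed.
Next Obligation. by move=> C D [f1 f2] e /=; rewrite !comp_idl. Qed.
Next Obligation. by move=> C D [f1 f2] e /=; rewrite !comp_idr. Qed.
Next Obligation.
move=> C D h g f e e' e1 e2 /=; congr pair.
- exact: (@compA C _ _ _ (congr1 fst e) (congr1 fst e')).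
- exact: (@compA D _ _ _ (congr1 snd e) (congr1 snd e')).
Qed.

(* [T] is the product functor, and [u] the unit object, of a strict monoidal
   structure on [C] (all associativity and unit constraints are identities). *)
Record strict_monoidal (C : category) (T : functor (prod_cat C C) C)
    (u : Ob C) : Prop := StrictMonoidal {
  tens_obA : forall a b c : Ob C,
    fob T (a, fob T (b, c)) = fob T (fob T (a, b), c);
  tens_ob1l : forall a : Ob C, fob T (u, a) = a;
  tens_ob1r : forall a : Ob C, fob T (a, u) = a;
  tens_morA : forall f g h : Mor C,
    fmor T (f, fmor T (g, h)) = fmor T (fmor T (f, g), h);
  tens_mor1l : forall f : Mor C, fmor T (idm u, f) = f;
  tens_mor1r : forall f : Mor C, fmor T (f, idm u) = f
}.

Definition monoidal_product (C : category) (T : functor (prod_cat C C) C)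
  : Prop := exists u : Ob C, strict_monoidal T u.

(** * Quivers and their path categories *)

Record quiver := Quiver {
  vertex : choiceType;
  arrow : choiceType;
  src : arrow -> vertex;
  tgt : arrow -> vertex
}.

Fixpoint walk (Q : quiver) (x : vertex Q) (s : seq (arrow Q)) : bool :=
  if s is a :: s' then (src a == x) && walk (tgt a) s' else true.

(* A path is a start vertex together with its arrows in order of travel. *)
Record qpath (Q : quiver) := QPath {
  path_val : vertex Q * seq (arrow Q);
  path_walk : walk path_val.1 path_val.2
}.

HB.instance Definition _ (Q : quiver) := [isSub for @path_val Q].
HB.instance Definition _ (Q : quiver) := [Choice of qpath Q by <:].

Definition pstart (Q : quiver) (f : qpath Q) : vertex Q := (path_val f).1.
Definition parrows (Q : quiver) (f : qpath Q) : seq (arrow Q) := (path_val f).2.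

Lemma path_eta (Q : quiver) (f : qpath Q) :
  (pstart f, parrows f) = path_val f.
Proof. by case: f => [[]]. Qed.

Definition walk_end (Q : quiver) (x : vertex Q) (s : seq (arrow Q)) :=
  last x (map (@tgt Q) s).
Definition pend (Q : quiver) (f : qpath Q) : vertex Q :=
  walk_end (pstart f) (parrows f).

Lemma walk_cat (Q : quiver) (x : vertex Q) (s t : seq (arrow Q)) :
  walk x (s ++ t) = walk x s && walk (walk_end x s) t.
Proof. by elim: s x => //= a s IHs x; rewrite IHs andbA. Qed.

Definition trivial_path (Q : quiver) (x : vertex Q) : qpath Q :=
  @QPath Q (x, [::]) isT.

Fact path_comp_subproof (Q : quiver) (g f : qpath Q) :
  pstart g = pend f -> walk (pstart f) (parrows f ++ parrows g).
Proof.
move=> e; rewrite walk_cat (path_walk f) /=.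
by move: (path_walk g); rewrite -/(pstart g) e.
Qed.

Definition path_comp (Q : quiver) (g f : qpath Q) (e : pstart g = pend f) :
  qpath Q := @QPath Q (pstart f, parrows f ++ parrows g) (path_comp_subproof e).

Program Definition path_cat (Q : quiver) : category := {|
  Ob := vertex Q;
  Mor := qpath Q;
  dom := @pstart Q;
  cod := @pend Q;
  idm := @trivial_path Q;
  comp := @path_comp Q
|}.
Next Obligation. by []. Qed.
Next Obligation. by []. Qed.
Next Obligation. by []. Qed.
Next Obligation.
by move=> Q g f e; rewrite /pend /walk_end /= map_cat last_cat /= e.
Qed.
Next Obligation.
by move=> Q f e; apply: val_inj; rewrite /= cats0 path_eta.
Qed.
Next Obligation.
by move=> Q f e; apply: val_inj; rewrite /= -[RHS]path_eta.
Qed.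
Next Obligation.
by move=> Q h g f e e' e1 e2; apply: val_inj; rewrite /= /parrows /= catA.
Qed.

(** * Linear maps between free modules *)

Definition linext (k : fieldType) (K : choiceType) (V : lmodType k) (h : K -> V)
    (x : {malg k[K]}) : V :=
  \sum_(i <- msupp x) x@_i *: h i.

Lemma linextEw (k : fieldType) (K : choiceType) (V : lmodType k) (h : K -> V)
    (x : {malg k[K]}) (d : {fset K}) :
  fsubset (msupp x) d -> linext h x = \sum_(i <- d) x@_i *: h i.
Proof.
move=> le_xd; rewrite /linext (big_fset_incl _ le_xd) //= => i _ /mcoeff_outdom->.
by rewrite scale0r.
Qed.

Fact linext_is_linear (k : fieldType) (K : choiceType) (V : lmodType k)
  (h : K -> V) : linear (linext h).
Proof.
move=> c x y; pose d := fsetU (msupp x) (fsetU (msupp y) (msupp (c *: x + y))).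
have [sx sy sz] : [/\ fsubset (msupp x) d, fsubset (msupp y) d
    & fsubset (msupp (c *: x + y)) d].
  by split; apply/fsubsetP => i; rewrite !inE => ->; rewrite ?orbT.
rewrite (linextEw _ sx) (linextEw _ sy) (linextEw _ sz).
rewrite scaler_sumr -big_split /=; apply: eq_bigr => i _.
by rewrite mcoeffD mcoeffZ scalerDl scalerA.
Qed.

HB.instance Definition _ (k : fieldType) (K : choiceType) (V : lmodType k)
    (h : K -> V) :=
  GRing.isLinear.Build k {malg k[K]} V _ (linext h) (linext_is_linear h).

Lemma linextU (k : fieldType) (K : choiceType) (V : lmodType k) (h : K -> V)
  (i : K) : linext h << i >> = h i.
Proof.
by rewrite (@linextEw _ _ _ _ _ _ msuppU_le) big_seq_fset1 mcoeffUU scale1r.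
Qed.

(* The tensor product of the free modules k[A] and k[B] is the free module
   k[A * B], with << (a, b) >> standing for << a >> (x) << b >>. *)
Definition tens (k : fieldType) (A B : choiceType) (x : {malg k[A]})
    (y : {malg k[B]}) : {malg k[(A * B)%type]} :=
  \sum_(a <- msupp x) \sum_(b <- msupp y) << x@_a * y@_b *g (a, b) >>.

Definition tens_map (k : fieldType) (A B C D : choiceType)
    (h : {malg k[A]} -> {malg k[C]}) (h' : {malg k[B]} -> {malg k[D]}) :
    {malg k[(A * B)%type]} -> {malg k[(C * D)%type]} :=
  linext (fun ab : A * B => tens (h << ab.1 >>) (h' << ab.2 >>)).

Definition tens_swap (k : fieldType) (A B C D : choiceType) :
    {malg k[((A * B) * (C * D))%type]} -> {malg k[((A * C) * (B * D))%type]} :=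
  linext (fun z : (A * B) * (C * D) =>
    << ((z.1.1, z.2.1), (z.1.2, z.2.2)) >>).

(** * The path coalgebra *)

Fact path_take_subproof (Q : quiver) (f : qpath Q) (i : nat) :
  walk (pstart f) (take i (parrows f)).
Proof.
have : walk (pstart f) (parrows f) := path_walk f.
by rewrite -{1}(cat_take_drop i (parrows f)) walk_cat => /andP[].
Qed.

Fact path_drop_subproof (Q : quiver) (f : qpath Q) (i : nat) :
  walk (walk_end (pstart f) (take i (parrows f))) (drop i (parrows f)).
Proof.
have : walk (pstart f) (parrows f) := path_walk f.
by rewrite -{1}(cat_take_drop i (parrows f)) walk_cat => /andP[].
Qed.

Definition path_take (Q : quiver) (f : qpath Q) (i : nat) : qpath Q :=
  @QPath Q (pstart f, take i (parrows f)) (path_take_subproof f i).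
Definition path_drop (Q : quiver) (f : qpath Q) (i : nat) : qpath Q :=
  @QPath Q (walk_end (pstart f) (take i (parrows f)), drop i (parrows f))
    (path_drop_subproof f i).

(* The pairs (a, b) with a o b = f, see [factorsP] and [factors_uniq]. *)
Definition factors (Q : quiver) (f : qpath Q) : seq (qpath Q * qpath Q) :=
  [seq (path_drop f i, path_take f i) | i <- iota 0 (size (parrows f)).+1].

Lemma factorsP (Q : quiver) (f : qpath Q) (ab : qpath Q * qpath Q) :
  ab \in factors f <-> exists e : pstart ab.1 = pend ab.2, path_comp e = f.
Proof.
case: ab => a b /=; split=> [/mapP[i _ [-> ->]]|[e <-]].
  have e : pstart (path_drop f i) = pend (path_take f i) by [].
  by exists e; apply: val_inj; rewrite /= cat_take_drop -[RHS]path_eta.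
apply/mapP; exists (size (parrows b)).
  by rewrite mem_iota add0n ltnS /= size_cat leq_addr.
congr pair; apply: val_inj; rewrite /= -[LHS]path_eta /parrows /=.
  by rewrite take_size_cat // drop_size_cat // e.
by rewrite take_size_cat.
Qed.

Lemma factors_uniq (Q : quiver) (f : qpath Q) : uniq (factors f).
Proof.
rewrite map_inj_in_uniq ?iota_uniq // => i j.
rewrite !mem_iota !add0n !ltnS => /= le_i le_j [_ _ /(congr1 size)].
by rewrite !size_take_min (minn_idPl le_i) (minn_idPl le_j).
Qed.

Definition path_comult (k : fieldType) (Q : quiver) :
    {malg k[qpath Q]} -> {malg k[(qpath Q * qpath Q)%type]} :=
  linext (fun f : qpath Q => \sum_(ab <- factors f) << ab >>).

Definition path_counit (k : fieldType) (Q : quiver) : {malg k[qpath Q]} -> k :=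
  linext (V := k^o) (fun f : qpath Q => (parrows f == [::])%:R).

(* The tensor product coalgebra kQ (x) kQ. *)
Definition path_comult2 (k : fieldType) (Q : quiver)
    (z : {malg k[(qpath Q * qpath Q)%type]}) :=
  tens_swap (tens_map (@path_comult k Q) (@path_comult k Q) z).

Definition path_counit2 (k : fieldType) (Q : quiver) :
    {malg k[(qpath Q * qpath Q)%type]} -> k :=
  linext (V := k^o) (fun fg : qpath Q * qpath Q =>
    path_counit (<< fg.1 >> : {malg k[qpath Q]}) * path_counit << fg.2 >>).

(* The projections onto the components of degree 0 and 1, identified with the
   free modules on the vertices and on the arrows respectively. *)
Definition path_proj0 (k : fieldType) (Q : quiver) :
    {malg k[qpath Q]} -> {malg k[vertex Q]} :=
  linext (fun f : qpath Q =>
    if parrows f is [::] then << pstart f >> else 0).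

Definition path_proj1 (k : fieldType) (Q : quiver) :
    {malg k[qpath Q]} -> {malg k[arrow Q]} :=
  linext (fun f : qpath Q => if parrows f is [:: a] then << a >> else 0).

(** * Hopf quivers *)

Definition conjugates (G : groupType) (c : G) : set G :=
  [set y | exists x : G, y = (x * c * x^-1)%g].

Definition conj_class (G : groupType) : Type :=
  {C : set G | exists c : G, C = conjugates c}.

Definition class_of (G : groupType) (c : G) : conj_class G :=
  exist _ (conjugates c) (ex_intro _ c erefl).

Lemma class_ofJ (G : groupType) (c x : G) :
  class_of (x * c * x^-1)%g = class_of c.
Proof.
apply: eq_exist; apply/seteqP; split=> [_ [y ->]|_ [y ->]].
  by exists (y * x)%g; rewrite invgM !mulgA.
by exists (y * x^-1)%g; rewrite invgM invgK !mulgA !mulgVK.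
Qed.

Definition ramification (G : groupType) : Type := conj_class G -> nat.

(* [((c, g), j)] encodes the arrow (c (x) g)_j from g to cg, with j counted
   from 0. *)
Record hopf_arrow (G : groupType) (r : ramification G) := HopfArrow {
  harrow_val : G * G * nat;
  harrow_lt : (harrow_val.2 < r (class_of harrow_val.1.1))%N
}.

HB.instance Definition _ (G : groupType) (r : ramification G) :=
  [isSub for @harrow_val G r].
HB.instance Definition _ (G : groupType) (r : ramification G) :=
  [Choice of hopf_arrow r by <:].

Definition hopf_quiver (G : groupType) (r : ramification G) : quiver := {|
  vertex := G;
  arrow := hopf_arrow r;
  src := fun a => (harrow_val a).1.2;
  tgt := fun a => ((harrow_val a).1.1 * (harrow_val a).1.2)%g
|}.

Fact biact_subproof (G : groupType) (r : ramification G) (x : G)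
    (a : hopf_arrow r) :
  ((harrow_val a).2 < r (class_of (x * (harrow_val a).1.1 * x^-1)%g))%N.
Proof. by rewrite class_ofJ harrow_lt. Qed.

(* x (c (x) g)_j y = (x c x^-1 (x) x g y)_j *)
Definition biact (G : groupType) (r : ramification G) (x : G)
    (a : hopf_arrow r) (y : G) : hopf_arrow r :=
  @HopfArrow G r
    ((x * (harrow_val a).1.1 * x^-1)%g, (x * (harrow_val a).1.2 * y)%g,
     (harrow_val a).2)
    (biact_subproof x a).

Definition group_mul (k : fieldType) (G : groupType) :
    {malg k[(G * G)%type]} -> {malg k[G]} :=
  linext (fun xy : G * G => << (xy.1 * xy.2)%g >>).

Definition left_act (k : fieldType) (G : groupType) (r : ramification G) :
    {malg k[(G * hopf_arrow r)%type]} -> {malg k[hopf_arrow r]} :=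
  linext (fun xa : G * hopf_arrow r => << biact xa.1 xa.2 1%g >>).

Definition right_act (k : fieldType) (G : groupType) (r : ramification G) :
    {malg k[(hopf_arrow r * G)%type]} -> {malg k[hopf_arrow r]} :=
  linext (fun ay : hopf_arrow r * G => << biact 1%g ay.1 ay.2 >>).

(* [mu] is the multiplication, as a map kQ (x) kQ -> kQ, of the canonical
   Cibils-Rosso Hopf algebra on the path coalgebra of the Hopf quiver: the
   unique coalgebra map with the components of degree 0 and 1 given below. *)
Record cibils_rosso_mul (k : fieldType) (G : groupType) (r : ramification G)
    (mu : {malg k[(qpath (hopf_quiver r) * qpath (hopf_quiver r))%type]} ->
          {malg k[qpath (hopf_quiver r)]}) : Prop := CibilsRossoMul {
  cr_comult : forall z, path_comult (mu z) = tens_map mu mu (path_comult2 z);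
  cr_counit : forall z, path_counit (mu z) = path_counit2 z;
  cr_proj0 : forall z, path_proj0 (mu z) =
    group_mul (tens_map (@path_proj0 k (hopf_quiver r)) (@path_proj0 k _) z);
  cr_proj1 : forall z, path_proj1 (mu z) =
    left_act (tens_map (@path_proj0 k (hopf_quiver r)) (@path_proj1 k _) z) +
    right_act (tens_map (@path_proj1 k (hopf_quiver r)) (@path_proj0 k _) z)
}.

Definition bilinear_extension (k : fieldType) (Q : quiver)
    (mu : {malg k[(qpath Q * qpath Q)%type]} -> {malg k[qpath Q]})
    (T : functor (prod_cat (path_cat Q) (path_cat Q)) (path_cat Q)) : Prop :=
  forall f g : qpath Q, mu (tens << f >> << g >>) = << fmor T (f, g) >>.

(* Main.v *)
(** If [a] is an arrow from [s] to [t], functoriality of a monoidal product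
    would make the product [f] of [a] with itself a path of length 2, the
    composite of the arrows [a t] and [s a]. Hence the comultiplication of [f]
    has 3 terms, while [a (x) a] has 4 = 2 * 2 of them, each mapped to a pure
    tensor of paths; comparing the sums of the coefficients gives 3 = 4 in [k],
    in every characteristic. *)
Require Import Defs.
From HB Require Import structures.
From mathcomp Require Import all_boot all_algebra monalg.
From mathcomp Require Import classical_sets.
From mathcomp Require Import finmap.

Set Implicit Arguments.
Unset Strict Implicit.
Unset Printing Implicit Defensive.

Import GRing.Theory.
Local Open Scope ring_scope.

(** * Free modules, their tensor products and sums of coefficients *)

Section FreeModules.
Variable k : fieldType.

Lemma tensU (A B : choiceType) (a : A) (b : B) :
  tens (<< a >> : {malg k[A]}) << b >> = << (a, b) >>.
Proof.
rewrite /tens !msuppU oner_eq0 big_seq_fset1 big_seq_fset1.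
by rewrite !mcoeffUU mulr1.
Qed.

Lemma tens0l (A B : choiceType) (y : {malg k[B]}) : tens (0 : {malg k[A]}) y = 0.
Proof. by rewrite /tens msupp0 big_seq_fset0. Qed.

Lemma malgU_scale (K : choiceType) (c : k) (i : K) :
  << c *g i >> = c *: (<< i >> : {malg k[K]}).
Proof. by apply/malgP => j; rewrite mcoeffZ !mcoeffU mulr_natr. Qed.

Lemma malgU_neq0 (K : choiceType) (i : K) : (<< i >> : {malg k[K]}) != 0.
Proof.
by apply/eqP => /(congr1 (mcoeff i))/eqP; rewrite mcoeffUU mcoeff0 oner_eq0.
Qed.

Lemma malg_linear_ext (K : choiceType) (V : lmodType k)
    (f g : {linear {malg k[K]} -> V}) :
  (forall i, f << i >> = g << i >>) -> f =1 g.
Proof.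
move=> fg x; rewrite [x]monalgE !linear_sum; apply: eq_bigr => i _.
by rewrite malgU_scale !linearZ fg.
Qed.

(** This is the sum of the coefficients: on a sum of basis elements it counts the terms, as an
    element of [k]. On [kQ] it differs from the counit, since it is 1 on every path. *)
Definition augmentation (K : choiceType) : {malg k[K]} -> k^o :=
  linext (fun _ => 1).

HB.instance Definition _ (K : choiceType) :=
  GRing.Linear.on (@augmentation K).

Lemma augmentationU (K : choiceType) (c : k) (i : K) :
  augmentation << c *g i >> = c.
Proof. by rewrite malgU_scale linearZ /= /augmentation linextU [LHS]mulr1. Qed.

Lemma augmentationE (K : choiceType) (x : {malg k[K]}) :
  augmentation x = \sum_(i <- msupp x) x@_i.
Proof. by apply: eq_bigr => i _; apply: mulr1. Qed.

Lemma augmentation_tens (A B : choiceType) (x : {malg k[A]}) (y : {malg k[B]}) :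
  augmentation (tens x y) = augmentation x * augmentation y.
Proof.
rewrite (augmentationE x) (augmentationE y) mulr_suml linear_sum.
apply: eq_bigr => a _; rewrite mulr_sumr linear_sum.
by apply: eq_bigr => b _; apply: augmentationU.
Qed.

Lemma tens_mapU (A B C D : choiceType) (h : {malg k[A]} -> {malg k[C]})
    (h' : {malg k[B]} -> {malg k[D]}) (a : A) (b : B) :
  tens_map h h' << (a, b) >> = tens (h << a >>) (h' << b >>).
Proof. exact: linextU. Qed.

(* Rewriting with [tens_mapU] and then in both factors at once makes unification
   compare distinct basis elements by unfolding them, which diverges. *)
Lemma tens_mapUE (A B C D : choiceType) (h : {malg k[A]} -> {malg k[C]})
    (h' : {malg k[B]} -> {malg k[D]}) (a : A) (b : B) x y :
  h << a >> = x -> h' << b >> = y -> tens_map h h' << (a, b) >> = tens x y.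
Proof. by rewrite tens_mapU => -> ->. Qed.

Lemma tens_swapU (A B C D : choiceType) (a : A) (b : B) (c : C) (d : D) :
  tens_swap (<< ((a, b), (c, d)) >> : {malg k[_]}) = << ((a, c), (b, d)) >>.
Proof. exact: linextU. Qed.

HB.instance Definition _ (A B C D : choiceType)
    (h : {malg k[A]} -> {malg k[C]}) (h' : {malg k[B]} -> {malg k[D]}) :=
  GRing.Linear.on (tens_map h h').

HB.instance Definition _ (A B C D : choiceType) :=
  GRing.Linear.on (@tens_swap k A B C D).

(** All the maps involved send basis elements to basis elements, so no coefficient sum changes. For
    [h = h' = mu], this is where it matters that a product of two paths is a single path. *)
Lemma augmentation_tens_map (A B C D E F : choiceType)
    (h : {malg k[(A * C)%type]} -> {malg k[E]})
    (h' : {malg k[(B * D)%type]} -> {malg k[F]}) (T : A * C -> E) (T' : B * D -> F) :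
  (forall a c, h << (a, c) >> = << T (a, c) >>) ->
  (forall b d, h' << (b, d) >> = << T' (b, d) >>) ->
  forall z : {malg k[((A * B) * (C * D))%type]},
  augmentation (tens_map h h' (tens_swap z)) = augmentation z.
Proof.
move=> hT hT'; apply: (malg_linear_ext
  (f := @augmentation _ \o tens_map h h' \o @tens_swap _ _ _ _ _)
  (g := @augmentation _)) => -[[a b] [c d]] /=.
by rewrite tens_swapU tens_mapU hT hT' tensU !augmentationU.
Qed.

End FreeModules.

(** * Path lengths read off from the path coalgebra *)

Section Paths.
Variables (k : fieldType) (Q : quiver).

Definition arrow_path (a : arrow Q) : qpath Q :=
  @QPath Q (src a, [:: a]) (introT andP (conj (eqxx _) isT)).

Lemma path_comultU (f : qpath Q) :
  path_comult (<< f >> : {malg k[qpath Q]}) = \sum_(ab <- factors f) << ab >>.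
Proof. exact: linextU. Qed.

Lemma path_proj0U (f : qpath Q) :
  path_proj0 (<< f >> : {malg k[qpath Q]}) =
  if parrows f is [::] then << pstart f >> else 0.
Proof. exact: linextU. Qed.

Lemma path_proj1U (f : qpath Q) :
  path_proj1 (<< f >> : {malg k[qpath Q]}) =
  if parrows f is [:: a] then << a >> else 0.
Proof. exact: linextU. Qed.

Lemma size_path_proj1 (f : qpath Q) :
  path_proj1 (<< f >> : {malg k[qpath Q]}) != 0 -> size (parrows f) = 1%N.
Proof. by rewrite path_proj1U; case: (parrows f) => [|a []] //; rewrite eqxx. Qed.

(** A path of length [n] can be cut at [n + 1] places, the two ends included. *)
Lemma augmentation_path_comult (f : qpath Q) :
  augmentation (path_comult (<< f >> : {malg k[qpath Q]}))
  = (size (parrows f)).+1%:R.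
Proof.
rewrite path_comultU linear_sum /= (eq_bigr (fun=> 1)) => [|i _]; last first.
  by rewrite augmentationU.
by rewrite big_const_seq count_predT size_map size_iota iter_addr_0.
Qed.

Lemma augmentation_comult2 (f g : qpath Q) :
  augmentation (tens (path_comult (<< f >> : {malg k[qpath Q]}))
    (path_comult << g >>)) = ((size (parrows f)).+1 * (size (parrows g)).+1)%:R.
Proof. by rewrite natrM -!augmentation_path_comult; apply: augmentation_tens. Qed.

HB.instance Definition _ := GRing.Linear.on (@path_proj0 k Q).

Lemma arrowless_path (f : qpath Q) :
  [set: arrow Q]%classic = set0 -> f = trivial_path (pstart f).
Proof.
move=> Q0; apply: val_inj; rewrite /= -path_eta.
case: (parrows f) => // a s.
by have: [set: arrow Q]%classic a by []; rewrite Q0.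
Qed.

(** Without arrows [kQ] is concentrated in degree 0; the inverse of the projection sends a vertex to
    its trivial path. *)
Lemma arrowless_path_proj0_inj :
  [set: arrow Q]%classic = set0 -> injective (@path_proj0 k Q).
Proof.
move=> Q0.
pose h := linext (fun x : vertex Q => << trivial_path x >> : {malg k[qpath Q]}).
apply: (can_inj (g := h)) => z.
apply: (malg_linear_ext (f := h \o @path_proj0 k Q) (g := idfun)) => f /=.
by rewrite (arrowless_path f Q0) path_proj0U /= /h linextU.
Qed.

End Paths.

(** * Products with trivial paths in low degree *)

Section CibilsRosso.
Variables (k : fieldType) (G : groupType) (r : ramification G).
Let Q := hopf_quiver r.
Variable mu : {malg k[(qpath Q * qpath Q)%type]} -> {malg k[qpath Q]}.
Hypothesis mu_canonical : cibils_rosso_mul mu.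

Lemma cr_proj0_trivial (x y : G) :
  path_proj0 (mu << (trivial_path (Q := Q) x, trivial_path (Q := Q) y) >>)
  = << (x * y)%g >>.
Proof.
rewrite (cr_proj0 mu_canonical).
rewrite (tens_mapUE (path_proj0U _ _) (path_proj0U _ _)) /= tensU.
by rewrite /group_mul linextU.
Qed.

(** Only the left action contributes: the other summand contains the degree 1 part of a trivial
    path, which is 0. *)
Lemma cr_proj1_trivial_arrow (x : G) (a : arrow Q) :
  path_proj1 (mu << (trivial_path (Q := Q) x, arrow_path a) >>)
  = << biact x a 1%g >>.
Proof.
rewrite (cr_proj1 mu_canonical).
rewrite [X in left_act X](tens_mapUE (path_proj0U _ _) (path_proj1U _ _)).
rewrite [X in right_act X](tens_mapUE (path_proj1U _ _) (path_proj0U _ _)) /=.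
by rewrite tensU tens0l /left_act /right_act linextU linear0 addr0.
Qed.

Lemma cr_proj1_arrow_trivial (x : G) (a : arrow Q) :
  path_proj1 (mu << (arrow_path a, trivial_path (Q := Q) x) >>)
  = << biact 1%g a x >>.
Proof.
rewrite (cr_proj1 mu_canonical).
rewrite [X in left_act X](tens_mapUE (path_proj0U _ _) (path_proj1U _ _)).
rewrite [X in right_act X](tens_mapUE (path_proj1U _ _) (path_proj0U _ _)) /=.
by rewrite tensU tens0l /left_act /right_act linextU linear0 add0r.
Qed.

End CibilsRosso.

(** * Path lengths under a functor of two variables *)

Section Functor.
Variables (Q : quiver)
  (T : functor (prod_cat (path_cat Q) (path_cat Q)) (path_cat Q)).

(** This is the interchange law, combined with the additivity of length under concatenation. *)
Lemma size_functor_comp (g f g' f' : qpath Q) (e : pstart g = pend f)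
    (e' : pstart g' = pend f') :
  size (parrows (fmor T (path_comp e, path_comp e'))) =
  (size (parrows (fmor T (g, g'))) + size (parrows (fmor T (f, f'))))%N.
Proof.
pose D := prod_cat (path_cat Q) (path_cat Q).
have ee' : @dom D (g, g') = @cod D (f, f') by rewrite /= e e'.
have eT : dom (fmor T (g, g')) = cod (fmor T (f, f')).
  by rewrite dom_fmor cod_fmor ee'.
have -> : (path_comp e, path_comp e') = Defs.comp ee'.
  (* The two sides differ only in their proofs of composability. *)
  by congr pair; apply: val_inj.
by rewrite (@fmor_comp _ _ T _ _ ee' eT) /= /parrows /= size_cat addnC.
Qed.

(** In the product category, [(a, a)] is [(i_s, a)] followed by [(a, i_t)], where [s] and [t] are
    the source and target of [a]. *)
Lemma size_functor_arrow_path (a : arrow Q) :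
  size (parrows (fmor T (arrow_path a, arrow_path a))) =
  (size (parrows (fmor T (arrow_path a, trivial_path (tgt a)))) +
   size (parrows (fmor T (trivial_path (src a), arrow_path a))))%N.
Proof.
have el : pstart (arrow_path a) = pend (trivial_path (src a)) by [].
have er : pstart (trivial_path (tgt a)) = pend (arrow_path a) by [].
by rewrite -(size_functor_comp el er); congr (size (parrows (fmor T (_, _))));
  apply: val_inj.
Qed.

End Functor.

(** * The group as a discrete strict monoidal category *)

Section ArrowlessTensor.
Variables (G : groupType) (r : ramification G).
Let Q := hopf_quiver r.
Hypothesis Q0 : [set: arrow Q]%classic = set0.

Lemma arrowless_pend (f : qpath Q) : pend f = pstart f.
Proof. by rewrite (arrowless_path f Q0). Qed.

Program Definition arrowless_tensor :
    functor (prod_cat (path_cat Q) (path_cat Q)) (path_cat Q) := {|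
  fob := fun xy : G * G => (xy.1 * xy.2)%g : vertex Q;
  fmor := fun fg : qpath Q * qpath Q =>
    trivial_path (Q := Q) (pstart fg.1 * pstart fg.2 : G)%g
|}.
Next Obligation. by []. Qed.
Next Obligation. by move=> [f g] /=; rewrite !arrowless_pend. Qed.
Next Obligation. by []. Qed.
Next Obligation.
by move=> g f e e'; apply: val_inj.
Qed.

Lemma arrowless_tensor_monoidal : monoidal_product arrowless_tensor.
Proof.
exists (1%g : G); split=> /=.
- by move=> a b c; rewrite mulgA.
- by move=> a; rewrite mul1g.
- by move=> a; rewrite mulg1.
- by move=> f g h; rewrite /pstart /= mulgA.
- by move=> f; rewrite /= mul1g [RHS](arrowless_path _ Q0).
- by move=> f; rewrite /= mulg1 [RHS](arrowless_path _ Q0).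
Qed.

End ArrowlessTensor.

Theorem theorem2 (k : fieldType) (G : groupType) (r : ramification G)
    (mu : {linear {malg k[(qpath (hopf_quiver r) * qpath (hopf_quiver r))%type]}
             -> {malg k[qpath (hopf_quiver r)]}})
    (mu_canonical : cibils_rosso_mul mu) :
  (exists T : functor (prod_cat (path_cat (hopf_quiver r))
                                (path_cat (hopf_quiver r)))
                      (path_cat (hopf_quiver r)),
     monoidal_product T /\ bilinear_extension mu T)
  <-> [set: arrow (hopf_quiver r)]%classic = set0.
Proof.
split=> [[T [_ muT]]|Q0].
  apply/seteqP; split=> // a _.
  have muTU f g : mu << (f, g) >> = << fmor T (f, g) >> by rewrite -muT tensU.
  (* The degree 1 part of this product is a basis arrow, hence nonzero, and the product is a single
     path, so it has length 1. *)
  have sl : size (parrows (fmor T (trivial_path (src a), arrow_path a))) = 1%N.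
    apply: (@size_path_proj1 k).
    by rewrite -muTU cr_proj1_trivial_arrow // malgU_neq0.
  have sr : size (parrows (fmor T (arrow_path a, trivial_path (tgt a)))) = 1%N.
    apply: (@size_path_proj1 k).
    by rewrite -muTU cr_proj1_arrow_trivial // malgU_neq0.
  have := congr1 (@augmentation k _)
    (cr_comult mu_canonical << (arrow_path a, arrow_path a) >>).
  rewrite /path_comult2 tens_mapU (augmentation_tens_map muTU muTU).
  rewrite augmentation_comult2 muTU augmentation_path_comult.
  rewrite size_functor_arrow_path sl sr => /eqP.
  (* The counts are 3 and 4; their difference is 1, which is nonzero in any field. *)
  by rewrite eq_sym -subr_eq0 -natrB // oner_eq0.
exists (arrowless_tensor Q0); split; first exact: arrowless_tensor_monoidal.
(* It suffices to compare degree 0 parts, where [mu] is the multiplication of the group algebra. *)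
move=> f g; apply: (arrowless_path_proj0_inj Q0).
rewrite tensU {1}(arrowless_path f Q0) {1}(arrowless_path g Q0).
by rewrite cr_proj0_trivial // path_proj0U.
Qed.
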